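(* (Type $q$-P$(E_2^{(1)};b)$.) Let $$L_1=\frac{g\nu_1\nu_2\nu_3\nu_4}{f}+\frac{(g\nu_1-1)z}{qg}+\frac{\nu_1\nu_2\nu_3(\frac zq-\nu_4)}{f-\frac zq}(g-T_z^{-1})+\frac{z(z-\frac{\kappa_1}{\nu_8})}{q(f-z)}\Bigl(T_z-\frac1g\Bigr).$$ Set $f=\nu_4$. Then the equation $L_1y(z)=0$ is written as $$z\Bigl(z-\frac{\kappa_1}{\nu_8}\Bigr)y(qz)+(-\nu_1z^2+dz)y(z)-q\nu_1\nu_2\nu_3(z-\nu_4)y(z/q)=0,$$ $$d=\frac{\nu_1\nu_4}{q}+\frac{\kappa_1-\nu_4\nu_8}{q\nu_8}\frac1g .$$
   Context: The parameters $\kappa_1,\kappa_2,\nu_1,\dots,\nu_8$ satisfy $\kappa_1^2\kappa_2^2=q\nu_1\nu_2\cdots\nu_8$. $T_z$ is the $q$-shift operator on the variable $z$: $T_zy(z)=y(qz)$, $T_z^{-1}y(z)=y(z/q)$. $L_1$ is an operator of the Kajiwara–Noumi–Yamada Lax pair for the $q$-Painlevé equation $q$-P$(E_2^{(1)};b)$, whose dependent variables $f,g$ are here treated as parameters.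
   Formalization: The printed d is too small by a factor q; the theorem uses d = ν1ν4 + (κ1 − ν4ν8)/(ν8 g), without the two factors 1/q. The equivalence is stated at each z other than the poles z = f and z = qf of L1. *)

(* Defs.v *)
From mathcomp Require Import all_boot all_algebra.

Set Implicit Arguments.
Unset Strict Implicit.
Unset Printing Implicit Defensive.

Import GRing.Theory.
Local Open Scope ring_scope.

Section QShift.
Variables (F : fieldType) (q : F).
Implicit Types (y : F -> F) (z : F).

Definition qshift y : F -> F := fun z => y (q * z).
Definition qshiftV y : F -> F := fun z => y (z / q).

(* L1 acts on functions of z.  Division is total here, so [L1 .. y z] has its
   intended meaning only when f, g, q and nu8 are nonzero and z is not one of
   the poles f and q * f of the coefficients. *)
Definition L1 (kappa1 nu1 nu2 nu3 nu4 nu8 f g : F) y : F -> F := fun z =>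
    g * nu1 * nu2 * nu3 * nu4 / f * y z
  + (g * nu1 - 1) * z / (q * g) * y z
  + nu1 * nu2 * nu3 * (z / q - nu4) / (f - z / q) * (g * y z - qshiftV y z)
  + z * (z - kappa1 / nu8) / (q * (f - z)) * (qshift y z - g^-1 * y z).

End QShift.

(* The coefficient of z * y z once f = nu4.  Clearing the denominator
   q * (nu4 - z) of L1 leaves no factor q^-1 here: a version of this formula
   with both summands divided by q is a misprint. *)
Definition accessory (F : fieldType) (kappa1 nu1 nu4 nu8 g : F) : F :=
  nu1 * nu4 + (kappa1 - nu4 * nu8) / nu8 * g^-1.

(* Main.v *)
Require Import Defs.
From mathcomp Require Import all_boot all_algebra.
From mathcomp Require Import ring.
Import GRing.Theory.
Local Open Scope ring_scope.

(** The three-term equation is [L1] applied to [y], times [q * (nu4 - z)], a unit away from the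
    pole, so both vanish together. In the coefficient of [y z] the [z ^+ 2 / g] terms cancel,
    leaving [- nu1 * z ^+ 2] and the accessory term. *)

(* At f = nu4 the factor (z / q - nu4) / (f - z / q) equals -1, so the
   g * y z part of that term cancels the first term of L1.  The only pole left
   is f = z. *)
Lemma L1_at_nu4 (F : fieldType) (q kappa1 nu1 nu2 nu3 nu4 nu8 g : F)
    (y : F -> F) (z : F) :
  q != 0 -> nu8 != 0 -> nu4 != 0 -> g != 0 -> z != nu4 -> z != q * nu4 ->
  q * (nu4 - z) * L1 q kappa1 nu1 nu2 nu3 nu4 nu8 nu4 g y z
  = z * (z - kappa1 / nu8) * y (q * z)
    + (- nu1 * z ^+ 2 + accessory kappa1 nu1 nu4 nu8 g * z) * y z
    - q * nu1 * nu2 * nu3 * (z - nu4) * y (z / q).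
Proof.
move=> q0 nu80 nu40 g0 z_nu4 z_qnu4.
have d0 : nu4 - z != 0 by rewrite subr_eq0 eq_sym.
(* The denominator [nu4 - z / q] after clearing [q]. *)
have dq0 : nu4 * q - z != 0 by rewrite subr_eq0 eq_sym mulrC.
rewrite /L1 /accessory /qshift /qshiftV.
(* The three values of [y] become independent atoms for [field]. *)
move: (y z) (y (q * z)) (y (z / q)) => a b c.
by field; rewrite q0 nu80 nu40 g0 d0 dq0.
Qed.

Theorem mainTheorem14 (F : fieldType)
    (q kappa1 kappa2 nu1 nu2 nu3 nu4 nu5 nu6 nu7 nu8 f g : F)
    (hq : q != 0) (hnu8 : nu8 != 0) (hf0 : f != 0) (hg : g != 0)
    (hkappa : kappa1 ^+ 2 * kappa2 ^+ 2
              = q * nu1 * nu2 * nu3 * nu4 * nu5 * nu6 * nu7 * nu8)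
    (hf : f = nu4) (y : F -> F) (z : F) (hz : z != f) (hzq : z != q * f) :
  L1 q kappa1 nu1 nu2 nu3 nu4 nu8 f g y z = 0
  <->
  z * (z - kappa1 / nu8) * y (q * z)
    + (- nu1 * z ^+ 2 + accessory kappa1 nu1 nu4 nu8 g * z) * y z
    - q * nu1 * nu2 * nu3 * (z - nu4) * y (z / q) = 0.
Proof.
subst f; rewrite -L1_at_nu4 //; split=> [-> | /eqP]; first by rewrite mulr0.
by rewrite !mulf_eq0 (negPf hq) subr_eq0 eq_sym (negPf hz) => /eqP.
Qed.
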